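(* Let $\mathscr{H}$ be a reproducing kernel Hilbert space on a non-empty set $\Omega$. If $A\in \mathbb{B}(\mathscr{H})$ is positive (i.e. $A\geq 0$), then $$\|A\|_{ber}=\mathbf{ber}(A).$$
   Context: A reproducing kernel Hilbert space $\mathscr{H}$ on a non-empty set $\Omega$ is a Hilbert space of complex-valued functions on $\Omega$ such that for every $\lambda\in\Omega$ the evaluation map $f\mapsto f(\lambda)$ is a continuous linear functional on $\mathscr{H}$. For $\lambda\in\Omega$, $k_\lambda\in\mathscr{H}$ denotes the unique element with $f(\lambda)=\langle f,k_\lambda\rangle$ for all $f\in\mathscr{H}$; it is assumed that $k_\lambda\neq 0$ for all $\lambda\in\Omega$, and $\hat{k}_\lambda=k_\lambda/\|k_\lambda\|$ is the normalized reproducing kernel. $\mathbb{B}(\mathscr{H})$ is the algebra of bounded linear operators on $\mathscr{H}$; $A\in\mathbb{B}(\mathscr{H})$ is positive, written $A\ge 0$, if $\langle Ax,x\rangle\ge 0$ for all $x\in\mathscr{H}$. For $A\in\mathbb{B}(\mathscr{H})$, the Berezin number is $\mathbf{ber}(A)=\sup\{|\langle A\hat{k}_\lambda,\hat{k}_\lambda\rangle|:\lambda\in\Omega\}$ and the Berezin norm is $\|A\|_{ber}=\sup\{|\langle A\hat{k}_\lambda,\hat{k}_\mu\rangle|:\lambda,\mu\in\Omega\}$. *)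

(* Defs.v *)
From HB Require Import structures.
From mathcomp Require Import all_boot all_order all_algebra sesquilinear complex.
From mathcomp Require Import all_classical all_reals all_analysis.
From mathcomp Require Import ring lra.

Set Implicit Arguments.
Unset Strict Implicit.
Unset Printing Implicit Defensive.

Import Order.TTheory GRing.Theory Num.Theory numFieldNormedType.Exports.
Import ComplexField.Normc.

Local Open Scope classical_set_scope.
Local Open Scope ring_scope.

(* The norm of a normed module over R[i] takes its values in R[i], where
   0 <= z means that z is real and nonnegative. The inner product is linear
   in its first argument and conjugate-linear in the second one. *)
HB.mixin Record CompleteNormedModule_isHilbert (R : realType) H
    & CompleteNormedModule R[i] H := {
  inner : {dot H for Num.conj} ;
  inner_normE : forall x : H, `|x| ^+ 2 = inner x x
}.

#[short(type="hilbertType")]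
HB.structure Definition Hilbert (R : realType) :=
  {H of CompleteNormedModule R[i] H & CompleteNormedModule_isHilbert R H}.

Section Riesz.
Variables (R : realType) (H : hilbertType R).
Implicit Types x y z w : H.

Let nrm x : R := complex.Re `|x|.

Let nrmE x : `|x| = (nrm x)%:C%C.
Proof. by rewrite /nrm RRe_real// normr_real. Qed.

Let nrm_ge0 x : 0 <= nrm x.
Proof. by rewrite -ler0c -nrmE. Qed.

Let innerE x : inner x x = (nrm x ^+ 2)%:C%C.
Proof. by rewrite -inner_normE nrmE rmorphXn. Qed.

Let nrmD x y : nrm (x + y) <= nrm x + nrm y.
Proof. by rewrite -lecR rmorphD/= -!nrmE ler_normD. Qed.

Let nrmZ (r : R) x : 0 <= r -> nrm (r%:C%C *: x) = r * nrm x.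
Proof.
move=> r0; apply: (@complexI R); rewrite -nrmE normrZ nrmE rmorphM/=.
by rewrite ger0_norm// ler0c.
Qed.

Let parallelogram x y : nrm (x - y) ^+ 2 =
  2 * nrm x ^+ 2 + 2 * nrm y ^+ 2 - 4 * nrm (2^-1%:C%C *: (x + y)) ^+ 2.
Proof.
rewrite nrmZ ?invr_ge0// exprMn.
set q := nrm (x + y).
have -> : 4 * (2^-1 ^+ 2 * q ^+ 2) = q ^+ 2 by field.
rewrite {}/q; apply: (@complexI R).
rewrite rmorphB rmorphD !rmorphM/= !rmorph_nat -!expr2 -!nrmE !inner_normE.
rewrite dnormB dnormD/=.
by ring.
Qed.

Lemma inner_injr x y : (forall f : H, inner f x = inner f y) -> x = y.
Proof.
move=> /(_ (x - y)) xy; apply/eqP; rewrite -subr_eq0 -(dnorm_eq0 (@inner R H)).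
by rewrite linearBr/= subr_eq0; exact/eqP/xy.
Qed.

Theorem riesz (phi : {linear H -> R[i]^o}) :
  continuous phi -> exists k : H, forall f, phi f = inner f k.
Proof.
move=> phi_cont.
have [phi0|/existsNP[u /eqP phiu]] := pselect (forall x, phi x = 0).
  by exists 0 => f; rewrite phi0 linear0r.
pose E : set R := [set t | exists2 x, phi x = 1 & t = nrm x ^+ 2].
have E0 : has_inf E.
  split; last by exists 0 => _ [x _ ->]; exact: sqr_ge0.
  exists (nrm ((phi u)^-1 *: u) ^+ 2); exists ((phi u)^-1 *: u) => //.
  by rewrite linearZ/=; exact: mulVf.
pose d := inf E.
have d_le x : phi x = 1 -> d <= nrm x ^+ 2.
  by move=> x1; apply: ge_inf; [exact: E0.2|exists x].
have d_ge0 : 0 <= d.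
  by apply: lb_le_inf; [exact: E0.1|move=> _ [x _ ->]; exact: sqr_ge0].
have /choice[x_ x_P] : forall n, exists x,
    phi x = 1 /\ nrm x ^+ 2 < d + n.+1%:R^-1.
  move=> n; have n0 : 0 < n.+1%:R^-1 :> R by rewrite invr_gt0.
  by have [_ [x x1 ->] xd] := inf_adherent n0 E0; exists x.
have x1 n : phi (x_ n) = 1 by have [] := x_P n.
have xd n : nrm (x_ n) ^+ 2 < d + n.+1%:R^-1 by have [] := x_P n.
have archi (e : R) : 0 < e -> exists n, forall m, (n <= m)%N -> m.+1%:R^-1 < e.
  move=> e0; exists (Num.truncn e^-1) => m nm.
  rewrite -[e]invrK ltf_pV2 ?posrE ?invr_gt0// (lt_le_trans (Num.Theory.truncnS_gt _))//.
  by rewrite ler_nat.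
have half2 : (2^-1 : R)%:C%C + (2^-1 : R)%:C%C = 1 :> R[i].
  rewrite -(rmorphD (real_complex R)) (_ : 2^-1 + 2^-1 = 1) ?rmorph1//.
  by field.
have xx_lt n m : nrm (x_ n - x_ m) ^+ 2 < 2 * n.+1%:R^-1 + 2 * m.+1%:R^-1.
  rewrite parallelogram.
  have : d <= nrm (2^-1%:C%C *: (x_ n + x_ m)) ^+ 2.
    by apply: d_le; rewrite linearZ linearD/= !x1 -[RHS]half2 /GRing.scale/= mulrDr mulr1.
  move: (xd n) (xd m).
  move: (nrm (x_ n) ^+ 2) (nrm (x_ m) ^+ 2) (nrm _ ^+ 2) => a b c.
  by move: n.+1%:R^-1 m.+1%:R^-1 => i j; clearbody d; lra.
have x_cauchy : cauchy (x_ @ \oo).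
  apply: cauchy_exP => e e_gt0.
  have [e' e'0 ->] : exists2 e' : R, 0 < e' & e = e'%:C%C.
    move: e_gt0; rewrite ltcE => /andP[/eqP Ime Ree].
    by exists (complex.Re e) => //; apply/eqP; rewrite eq_complex/= Ime !eqxx.
  have e4 : 0 < e' ^+ 2 / 4 by rewrite divr_gt0// exprn_gt0.
  have [n nP] := archi _ e4; exists (x_ n), n => // m /= nm.
  rewrite -ball_normE/= nrmE ltcR -(@ltr_pXn2r _ 2)// ?nnegrE ?nrm_ge0 ?ltW//.
  rewrite (lt_le_trans (xx_lt _ _))//.
  move: (nP n (leqnn n)) (nP m nm).
  by move: n.+1%:R^-1 m.+1%:R^-1 (e' ^+ 2) => i j k; lra.
have /cvg_ex[/= z x_z] : cvg (x_ @ \oo) by exact: cauchy_cvg.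
have z1 : phi z = 1.
  have : phi (x_ n) @[n --> \oo] --> phi z by apply: cvg_comp x_z _; exact: phi_cont.
  under eq_fun do rewrite x1.
  by move=> /(cvg_unique _ (cvg_cst _)) => ->.
have nz : nrm z ^+ 2 <= d.
  rewrite leNgt; apply/negP => dz.
  pose s := Num.sqrt d; have s0 : 0 <= s by exact: sqrtr_ge0.
  have sd : s ^+ 2 = d by rewrite sqr_sqrtr.
  have sz : s < nrm z by rewrite -(@ltr_pXn2r _ 2)// ?nnegrE// sd.
  pose e := (nrm z - s) / 2; have e0 : 0 < e by rewrite divr_gt0// subr_gt0.
  have [n nP] := archi _ (exprn_gt0 2 e0).
  have eC0 : 0 < e%:C%C :> R[i] by rewrite ltcR.
  have [m _ mP] := (@cvgrPdist_lt _ _ _ _ _ x_ z).1 x_z _ eC0.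
  have := mP (maxn n m) (leq_maxr n m); rewrite /= nrmE ltcR => zx.
  have := nP (maxn n m) (leq_maxl n m); have := xd (maxn n m).
  set p := maxn n m in zx *; move=> xpd pe.
  have xs : nrm (x_ p) < s + e.
    have se : 0 <= s + e by rewrite addr_ge0// ltW.
    rewrite -(@ltr_pXn2r _ 2) ?nnegrE ?nrm_ge0// sqrrD sd.
    have : 0 <= s * e by rewrite mulr_ge0// ltW.
    move: xpd pe; move: (nrm (x_ p) ^+ 2) (e ^+ 2) (s * e) p.+1%:R^-1 => i j k l.
    by clearbody d; lra.
  have := nrmD (z - x_ p) (x_ p); rewrite subrK.
  by move: zx xs; rewrite /e; lra.
have z_min x : phi x = 1 -> inner z z <= inner x x.
  by move=> phix; rewrite !innerE lecR (le_trans nz)// d_le.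
have z_ortho w : phi w = 0 -> inner w z = 0.
  move=> w0; have [->|wN0] := eqVneq w 0; first by rewrite linear0l.
  pose a := inner z w / inner w w; pose p := z - a *: w.
  have ww : inner w w != 0 by rewrite dnorm_eq0.
  have pw : inner p w = 0 by rewrite linearBl/= linearZl_LR/= divfK// subrr.
  have p1 : phi p = 1.
    by rewrite linearB linearZ/= w0 z1 scaler0 subr0.
  have zp : z = p + a *: w by rewrite subrK.
  have paw : inner p (a *: w) = 0.
    by rewrite linearZr_LR/=; apply/eqP; rewrite mulf_eq0; apply/orP; right; exact/eqP.
  have := z_min _ p1; rewrite {1 2}zp dnormD paw rmorph0 !addr0.
  rewrite gerDl dnormZ => aw.
  have : `|a| ^+ 2 * inner w w == 0.
    by rewrite eq_le aw mulr_ge0// exprn_ge0.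
  rewrite mulf_eq0 (negPf ww) orbF expf_eq0/= normr_eq0 mulf_eq0 invr_eq0.
  rewrite (negPf ww) orbF => /eqP zw.
  by rewrite hermC/= mul1r; apply/eqP; rewrite conjC_eq0; exact/eqP.
have zN0 : inner z z != 0.
  rewrite dnorm_eq0; apply/eqP => z0; move: z1; rewrite z0 linear0 => /eqP.
  by rewrite eq_sym oner_eq0.
exists ((inner z z)^-1 *: z) => f.
have : inner (f - phi f *: z) z = 0.
  apply: z_ortho; rewrite linearB linearZ/= z1 /GRing.scale/= mulr1 subrr.
  by [].
rewrite linearBl/= linearZl_LR/= => /eqP; rewrite subr_eq0 => /eqP fz.
rewrite linearZr_LR/= fz fmorphV/= -[(inner z z)^*](_ : inner z z = _); last first.
  by rewrite [LHS]hermC mul1r.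
by rewrite mulrC mulfK.
Qed.
End Riesz.

(* feval f l is the value f(l): injectivity identifies the elements of the
   space with complex-valued functions on Omega, and linearity makes their
   vector space operations the pointwise ones. R[i]^o is R[i] with the
   topology given by the modulus. *)
Record rkhs (R : realType) (Omega : Type) := RKHS {
  rkhs_space :> hilbertType R ;
  feval : {linear rkhs_space -> (Omega -> R[i]^o)} ;
  feval_inj : injective feval ;
  feval_continuous : forall l : Omega, continuous (feval^~ l)
}.

Arguments feval {R Omega r}.

Section Kernel.
Variables (R : realType) (Omega : Type) (H : rkhs R Omega).

Lemma repr_kernel_exists (l : Omega) :
  exists k : H, forall f : H, feval f l = inner f k.
Proof.
pose phi : H -> R[i]^o := fun f => feval f l.
have phiL : linear phi by move=> a f g; rewrite /phi linearP.
pose L := GRing.isLinear.Build R[i] H R[i]^o *:%R phi phiL.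
pose phi' : {linear H -> R[i]^o} := HB.pack phi L.
exact: (@riesz R H phi' (@feval_continuous _ _ H l)).
Qed.

Definition repr_kernel (l : Omega) : H := projT1 (cid (repr_kernel_exists l)).

Lemma repr_kernelP (l : Omega) (f : H) : feval f l = inner f (repr_kernel l).
Proof. exact: projT2 (cid (repr_kernel_exists l)) f. Qed.

Lemma repr_kernel_unique (l : Omega) (k : H) :
  (forall f : H, feval f l = inner f k) -> k = repr_kernel l.
Proof. by move=> kP; apply: inner_injr => f; rewrite -kP repr_kernelP. Qed.

Definition normalized_kernel (l : Omega) : H := `|repr_kernel l|^-1 *: repr_kernel l.

Definition bounded_operator (A : {linear H -> H}) :=
  exists M : R, forall x : H, `|A x| <= M%:C%C * `|x|.

Definition positive_operator (A : {linear H -> H}) :=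
  forall x : H, 0 <= inner (A x) x.

(* normc is the R-valued modulus on R[i]. *)
Definition berezin_number (A : {linear H -> H}) : R :=
  sup [set normc (inner (A (normalized_kernel l)) (normalized_kernel l)) | l in [set: Omega]].

Definition berezin_norm (A : {linear H -> H}) : R :=
  sup [set normc (inner (A (normalized_kernel lm.1)) (normalized_kernel lm.2)) |
    lm in [set: Omega * Omega]].

End Kernel.

(* Main.v *)
(* For a positive operator A and unimodular c, positivity of
   <A (x + c y), x + c y> for c = -u and c = -i u, where u is the phase of
   <A x, y>, gives 2 |<A x, y>| <= <A x, x> + <A y, y>.  At normalized kernels
   the right-hand side is at most 2 ber(A).  For A = 1 the same inequality
   bounds |<A k, k>| by (|A k|^2 + |k|^2) / 2, so that ber(A) is finite. *)
Require Import Defs.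
From HB Require Import structures.
From mathcomp Require Import all_boot all_order all_algebra sesquilinear complex.
From mathcomp Require Import all_classical all_reals all_analysis.
From mathcomp Require Import lra.
Import Order.TTheory GRing.Theory Num.Theory numFieldNormedType.Exports.
Local Open Scope classical_set_scope.
Local Open Scope ring_scope.

Lemma normr_complexE (R : rcfType) (z : R[i]) :
  `|z| = (ComplexField.Normc.normc z)%:C%C.
Proof. by []. Qed.

Lemma positive_operator_polarization (R : realType) (H : hilbertType R)
    (A : {linear H -> H}) (x y : H) :
  (forall z : H, 0 <= inner (A z) z) ->
  2 * `|inner (A x) y| <= inner (A x) x + inner (A y) y.
Proof.
move=> A_ge0.
set a := inner (A x) x; set b := inner (A y) y.
set p := inner (A x) y; set q := inner (A y) x.
(* The diagonal part of the expansion is a + |c|^2 b, which is why c is taken of modulus 1. *)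
have expand (c : R[i]) : `|c| = 1 -> 0 <= (a + b) + (c^* * p + c * q).
  move=> c1; have := A_ge0 (x + c *: y).
  rewrite (linearD A) (linearZ_LR A)/= linearDl/= !linearDr/=.
  rewrite !linearZl_LR/= !linearZr_LR/=.
  rewrite -/a -/b -/p -/q -[c^* *: _]/(c^* * (c * b)) (mulrA c^*).
  rewrite [c^* * c]mulrC -normCK c1 expr1n mul1r.
  by congr (0 <= _); rewrite [c * q + b]addrC addrACA.
have ab0 : 0 <= a + b by apply: addr_ge0; exact: A_ge0.
have [p0|pN0] := eqVneq p 0; first by rewrite p0 normr0 mulr0.
have P0 : `|p| != 0 by rewrite normr_eq0.
pose u := p / `|p|.
have u1 : `|u| = 1 by rewrite normrM normfV normr_id divff.
have up : u^* * p = `|p|.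
  rewrite rmorphM fmorphV/= (CrealP (normr_real p)) mulrAC [X in X / _]mulrC.
  by rewrite -normCK expr2 mulfK.
clearbody u.
(* These choices turn [c^* * p] into -|p| and i|p|. As [0 <= z] forces z to be real and a + b is
   real, the imaginary part of [h2] gives Re(u q) = |p|; with this, the real part of [h1] becomes
   2|p| <= a + b. *)
have h1 := expand (- u); have h2 := expand (- ('i%C * u)).
have iC : ('i%C : R[i])^* = - 'i%C by apply/eqP; rewrite eq_complex/= !oppr0 !eqxx.
have i1 : `|'i%C : R[i]| = 1.
  by apply/eqP; rewrite -(@eqrXn2 _ 2)// normCK iC mulrN -expr2 sqr_i opprK expr1n.
move: h1 h2; rewrite !normrN u1 normrM u1 i1 mulr1 => /(_ erefl) h1 /(_ erefl).
rewrite !rmorphN rmorphM/= iC !mulNr opprK -!mulrA up => h2.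
move: h1; rewrite rmorphN !mulNr up => h1.
have : a + b \is Num.real by rewrite ger0_real.
move: h1 h2; rewrite normr_complexE.
move: (ComplexField.Normc.normc p) (u * q) (a + b) => r [w1 w2] [s1 s2].
rewrite complex_real/= !lecE/=.
move=> /andP[/eqP/= e1 e2] /andP[/eqP/= e3 e4] /eqP e5.
apply/andP; split; [apply/eqP|]; lra.
Qed.

Theorem proposition2p10 (R : realType) (Omega : Type)
    (Omega_nonempty : inhabited Omega) (H : rkhs R Omega)
    (kernel_neq0 : forall l : Omega, repr_kernel H l != 0)
    (A : {linear H -> H}) (A_bounded : bounded_operator A)
    (A_positive : positive_operator A) :
  berezin_norm A = berezin_number A.
Proof.
pose k := normalized_kernel H.
have k1 l : `|k l| = 1 by rewrite normrZ normfV normr_id mulVf// normr_eq0.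
pose f l m := ComplexField.Normc.normc (inner (A (k l)) (k m)).
(* Positivity makes each diagonal value equal to its own modulus. *)
have diagE l : inner (A (k l)) (k l) = (f l l)%:C%C.
  by rewrite -normr_complexE ger0_norm.
have f_mean l m : 2 * f l m <= f l l + f m m.
  rewrite -lecR rmorphM rmorph_nat [leRHS]rmorphD/= -!diagE -normr_complexE.
  exact: positive_operator_polarization.
have [M AM] := A_bounded.
have AM1 l : `|A (k l)| <= M%:C%C by rewrite -[leRHS]mulr1 -(k1 l).
have diag_le l : 2 * f l l <= M ^+ 2 + 1.
  rewrite -lecR rmorphM rmorph_nat [leRHS]rmorphD rmorphXn rmorph1/= -normr_complexE.
  have := @positive_operator_polarization R H idfun (A (k l)) (k l).
  rewrite /= -!inner_normE k1 expr1n => polar.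
  apply: (le_trans (polar _)) => [z|]; first by rewrite -inner_normE exprn_ge0.
  (* Comparing squares requires 0 <= M, which follows from 0 <= |A (k l)| <= M. *)
  by rewrite lerD2r lerXn2r ?nnegrE ?(le_trans _ (AM1 l)).
(* The [sup] of an unbounded set is the default 0, so the explicit bound from [diag_le] is needed
   here. *)
have diag_ub l : f l l <= berezin_number A.
  apply: ub_le_sup; last by exists l.
  by exists ((M ^+ 2 + 1) / 2) => _ [m _ <-]; have := diag_le m; rewrite /f; lra.
have f_le l m : f l m <= berezin_number A.
  by have := f_mean l m; have := diag_ub l; have := diag_ub m; lra.
(* [ge_sup] asks for a nonempty set; [l0] provides an element of both. *)
have [l0] := Omega_nonempty.
apply/eqP; rewrite eq_le; apply/andP; split.
  by apply: ge_sup; [exists (f l0 l0), (l0, l0)|move=> _ [[l m] _ <-]; exact: f_le].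
(* Conversely, diagonal pairs are among all pairs, and [f_le] bounds the larger set. *)
apply: ge_sup; first by exists (f l0 l0), l0.
move=> _ [l _ <-]; apply: ub_le_sup; last by exists (l, l).
by exists (berezin_number A) => _ [[m n] _ <-]; exact: f_le.
Qed.
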